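(* The subspace $c_0$ is not complemented in $A_0$; that is, there is no bounded linear operator $P: A_0 \to c_0$ such that $Px = x$ for every $x \in c_0$.
   Context: $\mathbb{N}$ is the set of positive integers. $\ell_\infty$ is the space of all bounded real sequences $x=(x_1,x_2,\ldots)$ with the norm $\|x\| = \sup_{n\in\mathbb{N}} |x_n|$, and $c_0\subset \ell_\infty$ is the subspace of sequences converging to zero. For $x\in\ell_\infty$ put $\alpha(x) = \limsup_{i\to\infty} \max_{i<j\leq 2i} |x_i - x_j|$, and let $A_0 = \{x\in\ell_\infty : \alpha(x)=0\}$, a linear subspace of $\ell_\infty$ containing $c_0$, endowed with the norm of $\ell_\infty$. *)

(* Defs.v *)
From HB Require Import structures.
From mathcomp Require Import all_boot all_order all_algebra.
From mathcomp Require Import all_classical all_reals all_analysis.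
Import numFieldNormedType.Exports.
Set Implicit Arguments.
Unset Strict Implicit.
Unset Printing Implicit Defensive.
Import Order.TTheory GRing.Theory Num.Theory.
Local Open Scope classical_set_scope.
Local Open Scope ring_scope.

Section bounded_seq.
Context {R : realType}.

Definition bounded_seq : {pred nat -> R} := fun x => `[< bounded_fun x >].

Lemma bounded_funP (x : nat -> R) :
  bounded_fun x <-> exists M : R, forall n, `|x n| <= M.
Proof.
split=> [/pinfty_ex_gt0[M _ hM]|[M hM]].
- by exists M => n; apply: hM.
- exists M; split; first exact: num_real.
  by move=> r /ltW Mr n _; apply: le_trans Mr.
Qed.

Lemma bounded_seqP (x : nat -> R) :
  reflect (exists M : R, forall n, `|x n| <= M) (x \in bounded_seq).
Proof. by apply: (iffP (asboolP _)) => /bounded_funP. Qed.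

Lemma bounded_seq_submod_closed : submod_closed bounded_seq.
Proof.
split=> [|a x y /bounded_seqP[M hM] /bounded_seqP[N hN]]; apply/bounded_seqP.
- by exists 0 => n; rewrite normr0.
exists (`|a| * M + N) => n; apply: (le_trans (ler_normD _ _)).
by rewrite lerD// normrM ler_wpM2l.
Qed.

HB.instance Definition _ :=
  GRing.isSubmodClosed.Build _ _ bounded_seq bounded_seq_submod_closed.

End bounded_seq.

Record linf (R : realType) := Linf {
  linf_val :> nat -> R ;
  _ : linf_val \in bounded_seq }.

HB.instance Definition _ (R : realType) := [isSub for @linf_val R].
HB.instance Definition _ (R : realType) := [Choice of linf R by <:].
HB.instance Definition _ (R : realType) :=
  [SubChoice_isSubLmodule of linf R by <:].

Section linf_norm.
Context {R : realType}.
Implicit Types x y : linf R.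

Definition linf_norm x : R := sup (range (fun n => `|x n|)).

Lemma linf_has_ubound x : has_ubound (range (fun n => `|x n|)).
Proof.
case: x => x /= /bounded_seqP[M hM].
by exists M => _ [n _ <-].
Qed.

Lemma linf_norm_ub x n : `|x n| <= linf_norm x.
Proof. by apply: (ub_le_sup (linf_has_ubound x)); exists n. Qed.

Lemma linf_norm_le x (M : R) : (forall n, `|x n| <= M) -> linf_norm x <= M.
Proof.
move=> hM; apply: ge_sup; first by exists `|x 0%N|, 0%N.
by move=> _ [n _ <-].
Qed.

Lemma ler_linf_normD x y : linf_norm (x + y) <= linf_norm x + linf_norm y.
Proof.
apply: linf_norm_le => n; apply: (le_trans (ler_normD _ _)).
by rewrite lerD// linf_norm_ub.
Qed.

Lemma linf_normZ (a : R) x : linf_norm (a *: x) = `|a| * linf_norm x.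
Proof.
have le_normZ (b : R) y : linf_norm (b *: y) <= `|b| * linf_norm y.
  by apply: linf_norm_le => n; rewrite normrM ler_wpM2l// linf_norm_ub.
apply/eqP; rewrite eq_le le_normZ /=.
have [->|a0] := eqVneq a 0.
  rewrite normr0 mul0r.
  exact: le_trans (normr_ge0 _) (linf_norm_ub _ 0%N).
rewrite mulrC -ler_pdivlMr ?normr_gt0// mulrC -normfV.
by rewrite -{1}[x](scalerK a0) le_normZ.
Qed.

Lemma linf_norm_eq0 x : linf_norm x = 0 -> x = 0.
Proof.
move=> x0; apply/val_inj/funext => n; apply/eqP.
by rewrite -normr_le0 -x0 linf_norm_ub.
Qed.

HB.instance Definition _ := Lmodule_isNormed.Build R (linf R)
  ler_linf_normD linf_normZ linf_norm_eq0.

End linf_norm.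

(* A linear subspace S of V, as a normed space with the norm of V. *)
Record subspace (R : realType) (V : normedModType R) (S : submodClosed V) :=
  Subspace { subspace_val : V ; _ : subspace_val \in S }.

HB.instance Definition _ (R : realType) (V : normedModType R)
  (S : submodClosed V) := [isSub for @subspace_val R V S].
HB.instance Definition _ (R : realType) (V : normedModType R)
  (S : submodClosed V) := [Choice of subspace S by <:].
HB.instance Definition _ (R : realType) (V : normedModType R)
  (S : submodClosed V) := [SubChoice_isSubLmodule of subspace S by <:].

Section subspace_norm.
Context (R : realType) (V : normedModType R) (S : submodClosed V).
Implicit Types x y : subspace S.

Definition subspace_norm x : R := `|val x|.

Lemma ler_subspace_normD x y :
  subspace_norm (x + y) <= subspace_norm x + subspace_norm y.
Proof. exact: ler_normD. Qed.

Lemma subspace_normZ (a : R) x :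
  subspace_norm (a *: x) = `|a| * subspace_norm x.
Proof. exact: normrZ. Qed.

Lemma subspace_norm_eq0 x : subspace_norm x = 0 -> x = 0.
Proof. by move=> /normr0_eq0 x0; apply: val_inj. Qed.

HB.instance Definition _ := Lmodule_isNormed.Build R (subspace S)
  ler_subspace_normD subspace_normZ subspace_norm_eq0.

End subspace_norm.

Section c0_A0.
Context {R : realType}.
Implicit Types x y : linf R.

Definition null_seq : {pred linf R} :=
  fun x => `[< x n @[n --> \oo] --> (0 : R) >].

Lemma null_seq_submod_closed : submod_closed null_seq.
Proof.
split=> [|a x y /asboolP x0 /asboolP y0]; apply/asboolP.
- exact: cvg_cst.
- rewrite -[0 : R](addr0 0) -{1}(mulr0 a).
  by apply: cvgD => //; apply: cvgMr.
Qed.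

HB.instance Definition _ :=
  GRing.isSubmodClosed.Build _ _ null_seq null_seq_submod_closed.

(* x_n in the 1-based indexing of sequences: the first term is [x 0]. *)
Definition term x (n : nat) : R := x n.-1.

(* For i = 0 the range of j is empty and the value is 0, which does not affect
   the limsup below. For i > 0 the range is nonempty and the terms are
   nonnegative, so the default value 0 is harmless. *)
Definition max_osc x (i : nat) : R :=
  \big[Num.max/0]_(i.+1 <= j < (2 * i).+1) `|term x i - term x j|.

Definition alpha x : R := limn_sup (max_osc x).

Lemma max_osc_ge0 x i : 0 <= max_osc x i.
Proof. by rewrite /max_osc; elim/big_ind: _ => // a b a0 b0; rewrite le_max a0. Qed.

Lemma max_osc_le x i (M : R) : 0 <= M ->
  (forall j, (i < j <= 2 * i)%N -> `|term x i - term x j| <= M) ->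
  max_osc x i <= M.
Proof.
move=> M0 hM; rewrite /max_osc big_seq; elim/big_ind: _ => //.
- by move=> a b aM bM; rewrite ge_max aM.
- by move=> j; rewrite mem_index_iota ltnS => /hM.
Qed.

Lemma le_max_osc x i j : (i < j <= 2 * i)%N ->
  `|term x i - term x j| <= max_osc x i.
Proof.
move=> ij; rewrite /max_osc.
apply: (unstable.le_bigmax_seq _ j xpredT
  (fun j => `|term x i - term x j|)) => //.
by rewrite mem_index_iota ltnS.
Qed.

Lemma max_osc_bounded x : bounded_fun (max_osc x).
Proof.
apply/bounded_funP; exists (`|x| + `|x|) => i.
rewrite ger0_norm ?max_osc_ge0//; apply: max_osc_le => [|j _].
  by rewrite addr_ge0.
by apply: (le_trans (ler_normB _ _)); rewrite lerD// linf_norm_ub.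
Qed.

Lemma alpha_eq0P x : alpha x = 0 <-> max_osc x i @[i --> \oo] --> (0 : R).
Proof.
split=> [x0|/cvg_limn_inf_sup[]//].
have [ub lb] := (bounded_fun_has_ubound (max_osc_bounded x),
  bounded_fun_has_lbound (max_osc_bounded x)).
have cs : sups (max_osc x) @ \oo --> (0 : R).
  by rewrite -x0 /alpha limn_supE; [exact: cvg_sups_inf|exact: max_osc_bounded].
apply: (squeeze_cvgr _ (cvg_cst (0 : R)) cs); apply: nearW => i.
rewrite max_osc_ge0/=; apply: ub_le_sup; first exact: has_ubound_sdrop.
by exists i => /=.
Qed.

Definition slowly_osc : {pred linf R} := fun x => alpha x == 0.

Lemma slowly_osc_submod_closed : submod_closed slowly_osc.
Proof.
split=> [|a x y /eqP/alpha_eq0P x0 /eqP/alpha_eq0P y0];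
  apply/eqP/alpha_eq0P.
- rewrite (_ : max_osc 0 = fun=> 0); first exact: cvg_cst.
  apply/funext => i; apply/eqP; rewrite eq_le max_osc_ge0 andbT.
  by apply: max_osc_le => // j _; rewrite subrr normr0.
- have h : `|a| * max_osc x i + max_osc y i @[i --> \oo] --> (0 : R).
    rewrite -[0 : R](addr0 0) -{1}(mulr0 `|a|).
    by apply: cvgD => //; apply: cvgMr.
  apply: (squeeze_cvgr _ (cvg_cst (0 : R)) h); apply: nearW => i.
  rewrite max_osc_ge0/=; apply: max_osc_le => [|j ij].
    by rewrite addr_ge0 ?mulr_ge0 ?max_osc_ge0.
  have -> : term (a *: x + y) i - term (a *: x + y) j =
    a * (term x i - term x j) + (term y i - term y j).
    by rewrite mulrBr addrACA -opprD.
  apply: (le_trans (ler_normD _ _)); rewrite normrM.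
  by rewrite lerD ?ler_wpM2l ?le_max_osc.
Qed.

HB.instance Definition _ :=
  GRing.isSubmodClosed.Build _ _ slowly_osc slowly_osc_submod_closed.

Lemma null_seq_sub_slowly_osc : {subset null_seq <= slowly_osc}.
Proof.
move=> x /asboolP x0; apply/eqP/alpha_eq0P/cvgr0Pnorm_le => e e0.
have e20 : 0 < e / 2 by rewrite divr_gt0.
have [N _ hN] : \forall n \near \oo, `|x n| <= e / 2.
  by move/cvgr0Pnorm_le: x0; apply.
exists N.+1 => // i /= Ni; rewrite ger0_norm ?max_osc_ge0//.
apply: max_osc_le => [|j /andP[ij _]]; first exact: ltW.
apply: (le_trans (ler_normB _ _)); rewrite [leRHS]splitr.
have hT k : (N < k)%N -> `|term x k| <= e / 2.
  by case: k => // k; rewrite ltnS => /hN.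
by apply: lerD; apply: hT => //; apply: ltn_trans ij.
Qed.

End c0_A0.

Definition c0 (R : realType) : normedModType R := subspace (@null_seq R).
Definition A0 (R : realType) : normedModType R := subspace (@slowly_osc R).

(* Main.v *)
From HB Require Import structures.
Require Import Defs.
From mathcomp Require Import all_boot all_order all_algebra.
From mathcomp Require Import all_classical all_reals all_analysis.
From mathcomp Require Import zify lra.
Import numFieldNormedType.Exports.
Import Order.TTheory GRing.Theory Num.Theory.
Local Open Scope classical_set_scope.
Local Open Scope ring_scope.

(** The argument is Whitley's proof that [c0] is not complemented in the space
of bounded sequences, carried out inside [A0]. Index by the uncountable type
[nat -> bool] a family of functions [f_s] in [A0], all bounded by 1, such that
for [s <> t] the product [f_s f_t] vanishes at all large indices, and such that
no [f_s] is in [c0]. Let [P] be a bounded projection onto [c0]. Each functional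
[phi_n x = x n - (P x) n] is bounded and vanishes on [c0]. A signed finite sum
of functions [f_t] is bounded by 1 far out, and altering finitely many of its
terms does not change its image under [phi_n]; hence the sum of the
[`|phi_n f_t|] over any finite set of indices is at most a bound of [phi_n]
([sum_functional_le]). So [phi_n f_t] is nonzero for only countably many [t]
([countable_functional_neq0]), and by uncountability some [s] satisfies
[phi_n f_s = 0] for all [n]. Then [f_s = P f_s] is in [c0], a contradiction.

The functions [f_s] come from almost disjoint infinite sets of integers, the
sets of codes of the finite prefixes of [s] ([branch_almost_disjoint]). Passing
from [i] to [j] in [(i, 2i]] raises the binary logarithm of [i], rounded down,
by at most one, so a function of that logarithm is in [A0] as soon as its
consecutive differences tend to 0. On the logarithmic scale, take tents of
height 1/2 over the dyadic blocks [[2^k, 2^(k+1))] with [k > 0] in the given set: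
their slopes are at most [2^-k] ([tent_slow], [bump_slowly_osc]). *)

(** * An uncountable almost disjoint family *)

Lemma uncountable_nat_bool : ~ countable [set: nat -> bool].
Proof.
move=> /pcard_injP[f f_inj].
(* Cantor's diagonal along a putative numbering f. *)
pose d n := ~~ `[< exists2 t, f t = n & t n >].
have [dt|] := boolP (d (f d)); last first.
  by move=> nd; move: (nd); rewrite negbK => /asboolP[t /f_inj ->];
    rewrite ?inE// (negbTE nd).
by move: (dt) => /asboolP[]; exists d.
Qed.

Lemma unbounded_inj_nat (f : nat -> nat) (N : nat) :
  injective f -> exists l, (N <= f l)%N.
Proof.
move=> f_inj; apply: contrapT => fN.
have : (size (map f (iota 0 N.+1)) <= size (iota 0 N))%N.
  apply: uniq_leq_size; first by rewrite map_inj_uniq// iota_uniq.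
  move=> _ /mapP[l _ ->]; rewrite mem_iota /= add0n ltnNge.
  by apply/negP => Nl; apply: fN; exists l.
by rewrite size_map !size_iota ltnn.
Qed.

(** The set of codes of the finite prefixes of a binary sequence [s]: a branch
of the binary tree, whose nodes are numbered by [pickle]. *)
Definition branch (s : nat -> bool) : set nat :=
  range (fun l => pickle (mkseq s l)).

Lemma branch_unbounded s N : exists2 k, (N <= k)%N & branch s k.
Proof.
have [|l Nl] := @unbounded_inj_nat (fun l => pickle (mkseq s l)) N.
  by move=> l l' /(pcan_inj pickleK) /(congr1 size); rewrite !size_mkseq.
by exists (pickle (mkseq s l)) => //; exists l.
Qed.

Lemma branch_almost_disjoint s t : s <> t ->
  \forall k \near \oo, ~ (branch s k /\ branch t k).
Proof.
move=> st; have [i sti] : exists i, s i != t i.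
  apply: contrapT => h; apply: st; apply/funext => i; apply/eqP.
  by apply/negPn/negP => sti; apply: h; exists i.
exists (\max_(l < i.+1) pickle (mkseq s l)).+1 => // k /= ltk.
move=> [[l _ sl] [l' _ tl']].
(* A prefix of length at most i has its code below the bound; a longer one
   common to both branches would force s i = t i. *)
have [li|il] := leqP l i.
  move: ltk; rewrite -sl ltnNge => /negP; apply.
  have li' : (l < i.+1)%N by [].
  exact: (leq_bigmax (Ordinal li')).
have /(pcan_inj pickleK) stl : pickle (mkseq s l) = pickle (mkseq t l').
  by rewrite sl tl'.
have ll' : l = l' by move/(congr1 size): stl; rewrite !size_mkseq.
move/eqP: sti; apply; move/(congr1 (nth false ^~ i)): stl.
by rewrite -ll' !nth_mkseq.
Qed.

(** * Slowly oscillating bumps *)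

Lemma cvg_trunc_log : (trunc_log 2 n @[n --> \oo] --> \oo)%classic.
Proof.
apply/cvgnyPge => A; exists (2 ^ A)%N => // n /= An.
by apply: trunc_log_max.
Qed.

(** The distance from [m > 0] to the nearer endpoint of the interval
[[2 ^ k, 2 ^ k.+1]] whose half-open version contains [m]. *)
Definition tent_height (m : nat) : nat :=
  let k := trunc_log 2 m in minn (m - 2 ^ k) (2 ^ k.+1 - m).

Section tent.
Context {R : realType}.
Implicit Types A B : set nat.

(** The function which on the block [[2 ^ k, 2 ^ k.+1)] is a tent of slope
[2 ^- k] if [k] is in [A], and vanishes otherwise. *)
Definition tent A (m : nat) : R :=
  \1_A (trunc_log 2 m) * ((tent_height m)%:R / 2 ^+ trunc_log 2 m).

Lemma pow2_natr k : 2 ^+ k = (2 ^ k)%N%:R :> R.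
Proof. by rewrite natrX. Qed.

Lemma indic_norm_le1 A k : `|\1_A k : R| <= 1.
Proof. by rewrite indicE; case: (_ \in _); rewrite ?normr1// normr0. Qed.

Lemma tent_norm_le1 A m : `|tent A m| <= 1.
Proof.
rewrite normrM -[leRHS]mulr1 ler_pM ?indic_norm_le1//.
rewrite ger0_norm ?divr_ge0 ?exprn_ge0// ler_pdivrMr ?exprn_gt0// mul1r.
rewrite pow2_natr ler_nat /tent_height.
case: m => [|m]; first by rewrite sub0n min0n.
have /andP[] := @trunc_log_bounds 2 m.+1 isT isT.
by set k := trunc_log _ _; rewrite expnS; lia.
Qed.

Lemma tent_slow A m : (0 < m)%N ->
  `|tent A m - tent A m.+1| <= (2 ^+ trunc_log 2 m)^-1.
Proof.
move=> m0; have /andP[km mk] := @trunc_log_bounds 2 m isT m0.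
set k := trunc_log 2 m in km mk *.
have k0 : 0 < 2 ^+ k :> R by rewrite exprn_gt0.
have [mk'|mk'] := ltnP m.+1 (2 ^ k.+1).
  have Ek : trunc_log 2 m.+1 = k.
    by apply: trunc_log_eq => //; rewrite mk' leqW.
  rewrite /tent Ek -/k -mulrBr -mulrBl !normrM normfV (gtr0_norm k0).
  rewrite -[leRHS]mul1r ler_pM ?mulr_ge0 ?invr_ge0 ?(ltW k0) ?indic_norm_le1//.
  rewrite -[leRHS]mul1r ler_pM ?invr_ge0 ?(ltW k0)//.
  have /andP[h1 h2] : (tent_height m <= (tent_height m.+1).+1)%N &&
                   (tent_height m.+1 <= (tent_height m).+1)%N.
    by rewrite /tent_height Ek -/k; lia.
  move: h1 h2; rewrite -!(ler_nat R) !mulrSr => h1 h2.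
  by rewrite ler_norml; lra.
(* Otherwise m is the last point of its block, and the tent over the next block
   starts at 0. *)
have Em : m.+1 = (2 ^ k.+1)%N by apply/eqP; rewrite eqn_leq mk mk'.
have -> : tent A m.+1 = 0.
  by rewrite /tent /tent_height Em trunc_expnK// subnn min0n mul0r mulr0.
rewrite subr0 /tent -/k !normrM normfV (gtr0_norm k0).
rewrite -[leRHS]mul1r ler_pM ?mulr_ge0 ?invr_ge0 ?(ltW k0) ?indic_norm_le1//.
rewrite -[leRHS]mul1r ler_pM ?invr_ge0 ?(ltW k0)//.
rewrite ger0_norm// (ler_nat _ _ 1) /tent_height -/k -Em subSnn.
exact: geq_minr.
Qed.

Lemma tent_peak A k : A k.+1 -> tent A (3 * 2 ^ k) = 2^-1.
Proof.
move=> Ak; have Ek : trunc_log 2 (3 * 2 ^ k) = k.+1.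
  by apply: trunc_log_eq => //; rewrite !expnS; apply/andP; split; lia.
rewrite /tent /tent_height Ek indicE mem_set// mul1r.
rewrite (_ : minn _ _ = 2 ^ k)%N; last by rewrite !expnS; lia.
by rewrite exprS pow2_natr invfM mulrCA divff ?mulr1// -pow2_natr expf_neq0.
Qed.

Lemma tent_disjoint A B : (\forall k \near \oo, ~ (A k /\ B k)) ->
  \forall m \near \oo, tent A m * tent B m = 0.
Proof.
move=> /cvg_trunc_log/= AB.
have {}AB : \forall m \near \oo,
    ~ (A (trunc_log 2 m) /\ B (trunc_log 2 m)) by [].
near=> m; have ABm : ~ (A (trunc_log 2 m) /\ B (trunc_log 2 m)) by near: m.
rewrite /tent !indicE.
have [/set_mem Am|_] := boolP (_ \in A); last by rewrite !mul0r.
have [/set_mem Bm|_] := boolP (_ \in B); last by rewrite mul0r mulr0.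
by case: ABm.
Unshelve. all: by end_near. Qed.

(** The tents read on the logarithmic scale. Sequences are indexed from 0, so
the term of index [n] has number [n.+1]. *)
Definition bump_seq A (n : nat) : R := tent A (trunc_log 2 n.+1).

Lemma bump_seq_bounded A : bump_seq A \in bounded_seq.
Proof. by apply/bounded_seqP; exists 1 => n; apply: tent_norm_le1. Qed.

(** The bumps over [A], as a bounded sequence. *)
Definition bump_linf A : linf R := Linf (bump_seq_bounded A).

Lemma term_bump A i : term (bump_linf A) i = tent A (trunc_log 2 i).
Proof. by case: i. Qed.

Lemma bump_slowly_osc A : bump_linf A \in slowly_osc.
Proof.
apply/eqP/alpha_eq0P.
pose b (k : nat) : R := (2^-1) ^+ k.
have b0 : (b (trunc_log 2 (trunc_log 2 i)) @[i --> \oo] --> (0 : R))%classic.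
  have b0 : (b k @[k --> \oo] --> (0 : R))%classic.
    by apply: cvg_expr; rewrite ger0_norm ?invr_ge0// invf_lt1// ltr1n.
  by move=> X /b0 /cvg_trunc_log /cvg_trunc_log.
apply: (squeeze_cvgr _ (cvg_cst (0 : R)) b0); exists 2%N => // i /= i2.
rewrite max_osc_ge0/=; apply: max_osc_le => [|j /andP[ij ji]].
  by rewrite exprn_ge0// invr_ge0.
rewrite !term_bump; set m := trunc_log 2 i.
have m0 : (0 < m)%N by rewrite trunc_log_gt0.
have i0 : (0 < i)%N by exact: ltnW.
have mj : (m <= trunc_log 2 j)%N by apply: leq_trunc_log; apply: ltnW.
have jm : (trunc_log 2 j <= m.+1)%N.
  by rewrite -trunc_logMp ?leq_trunc_log.
rewrite /b exprVn.
have [->|->] : trunc_log 2 j = m \/ trunc_log 2 j = m.+1 by lia.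
- by rewrite subrr normr0 invr_ge0 exprn_ge0.
- exact: tent_slow.
Qed.

(** The bumps over [A], as an element of [A0]. *)
Definition bump A : A0 R := Subspace (bump_slowly_osc A).

Lemma bump_disjoint A B : (\forall k \near \oo, ~ (A k /\ B k)) ->
  \forall n \near \oo, bump_linf A n * bump_linf B n = 0.
Proof.
move=> /tent_disjoint AB.
have cS : trunc_log 2 n.+1 @[n --> \oo] --> \oo.
  apply/cvgnyPge => N; exists (2 ^ N)%N => // n /= Nn.
  by apply: trunc_log_max => //; apply: leqW.
exact: (cS _ AB).
Qed.

Lemma bump_notin_c0 A : (forall N, exists2 k, (N <= k)%N & A k) ->
  bump_linf A \notin null_seq.
Proof.
move=> A_unbounded; apply/negP => /asboolP/cvgr0Pnorm_lt.
have h2 : 0 < 2^-1 :> R by rewrite invr_gt0.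
move=> /(_ _ h2)[N _ small].
have [[//|k] Nk Ak] := A_unbounded N.+1.
(* The peak of the tent over block k.+1 is at m. *)
pose m := (3 * 2 ^ k)%N.
have Nm : (N <= (2 ^ m).-1)%N.
  have := ltn_expl k (isT : 1 < 2)%N; have := ltn_expl m (isT : 1 < 2)%N.
  by rewrite /m; lia.
have := small _ Nm; rewrite /= /bump_seq prednK ?expn_gt0//.
by rewrite trunc_expnK// tent_peak// gtr0_norm// ltxx.
Qed.

End tent.

(** * Finite sums and finite modifications *)

Section almost_disjoint_sum.
Context {R : realType} {T : choiceType} {f : T -> nat -> R}.
Context (f_le1 : forall t n, `|f t n| <= 1).
Context (f_disjoint : forall s t, s <> t ->
  \forall n \near \oo, f s n * f t n = 0).

Lemma almost_disjoint_sum_le1 (F : seq T) : uniq F ->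
  \forall n \near \oo, \sum_(t <- F) `|f t n| <= 1.
Proof.
elim: F => [_|t F IH /= /andP[tF /IH {}IH]].
  by apply: nearW => n; rewrite big_nil.
have tF0 : \forall n \near \oo, forall u, u \in F -> f t n * f u n = 0.
  elim: F tF {IH} => [_|u F IH]; first exact: nearW.
  rewrite in_cons negb_or => /andP[/eqP tu /IH {}IH].
  near=> n => v; rewrite in_cons => /orP[/eqP ->|].
  - by near: n; apply: f_disjoint.
  - by move: v; near: n.
near=> n; rewrite big_cons.
have F1 : \sum_(u <- F) `|f u n| <= 1 by near: n.
have t0 : forall u, u \in F -> f t n * f u n = 0 by near: n.
have [->|ft0] := eqVneq (f t n) 0; first by rewrite normr0 add0r.
rewrite big_seq big1 ?addr0// => u /t0/eqP.
by rewrite mulf_eq0 (negbTE ft0) => /eqP ->; rewrite normr0.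
Unshelve. all: by end_near. Qed.

End almost_disjoint_sum.

Section truncation.
Context {R : realType}.

(** The sequence [x] with its first [N] terms replaced by 0; [tail] and [tailA0]
are the same operation on bounded sequences and on [A0]. *)
Definition tail_seq (N : nat) (x : nat -> R) (n : nat) : R :=
  if (N <= n)%N then x n else 0.

Lemma tail_seq_bounded N (x : linf R) : tail_seq N x \in bounded_seq.
Proof.
apply/bounded_seqP; exists `|x| => n; rewrite /tail_seq.
by case: ifP => _; rewrite ?normr0// linf_norm_ub.
Qed.

Definition tail N (x : linf R) : linf R := Linf (tail_seq_bounded N x).

Lemma tail_sub_null N (x : linf R) : x - tail N x \in null_seq.
Proof.
apply/asboolP; apply: (@cvg_trans _ ((fun=> 0 : R) @ \oo)); last exact: cvg_cst.
apply: near_eq_cvg; exists N => // n /= Nn.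
by rewrite -[RHS]/(x n - tail_seq N x n) /tail_seq Nn subrr.
Qed.

Lemma tail_slowly_osc N (x : A0 R) : tail N (val x) \in slowly_osc.
Proof.
rewrite -[tail _ _](subKr (val x)) rpredB ?(valP x)//.
exact/null_seq_sub_slowly_osc/tail_sub_null.
Qed.

Definition tailA0 N (x : A0 R) : A0 R := Subspace (tail_slowly_osc N x).

End truncation.

Section pointwise_operations.
Context {R : realType}.

Lemma linf_addE (x y : linf R) n : (x + y) n = x n + y n.
Proof. by []. Qed.

Lemma linf_scaleE a (x : linf R) n : (a *: x) n = a * x n.
Proof. by []. Qed.

Lemma A0_valD (x y : A0 R) : val (x + y) = val x + val y.
Proof. by []. Qed.

Lemma A0_valZ a (x : A0 R) : val (a *: x) = a *: val x.
Proof. by []. Qed.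

Lemma A0_lincombE (I : Type) (F : seq I) (c : I -> R) (x : I -> A0 R) n :
  val (\sum_(i <- F) c i *: x i) n = \sum_(i <- F) c i * val (x i) n.
Proof.
elim: F => [|i F IH]; first by rewrite [RHS]big_nil [X in val X]big_nil.
rewrite [RHS]big_cons -IH [X in val X]big_cons.
by rewrite A0_valD linf_addE A0_valZ linf_scaleE.
Qed.

End pointwise_operations.

(** * Bounded functionals vanishing on c0 *)

Section functional_vanishing_on_c0.
Context {R : realType} {T : choiceType} {f : T -> A0 R}.
Context (f_le1 : forall t n, `|val (f t) n| <= 1).
Context (f_disjoint : forall s t, s <> t ->
  \forall n \near \oo, val (f s) n * val (f t) n = 0).

Context {phi : {scalar A0 R}} {C : R}.
Context (phi_le : forall x, `|phi x| <= C * `|x|).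
Context (phi_c0 : forall x, val x \in null_seq -> phi x = 0).

(** The left-hand side is the value of [phi] at the sum of the [f t] weighted by
the signs of [phi (f t)]; a tail of this sum has norm at most 1 and the same
value under [phi]. *)
Lemma sum_functional_le (F : seq T) : uniq F ->
  \sum_(t <- F) `|phi (f t)| <= `|C|.
Proof.
move=> /(almost_disjoint_sum_le1 f_le1 f_disjoint)[N _ tail_le1].
pose g := \sum_(t <- F) Num.sg (phi (f t)) *: f t.
have phig : phi g = \sum_(t <- F) `|phi (f t)|.
  rewrite linear_sum; apply: eq_bigr => t _; rewrite linearZ /=.
  exact: esym (normrEsg _).
have phi_tail : phi g = phi (tailA0 N g).
  apply/eqP; rewrite -subr_eq0 -linearB; apply/eqP/phi_c0.
  exact: tail_sub_null.
have norm_tail : `|tailA0 N g| <= 1.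
  apply: linf_norm_le => n; rewrite /= /tail_seq.
  case: ifP => [Nn|_]; last by rewrite normr0.
  have -> : (val g : linf R) n =
      \sum_(t <- F) Num.sg (phi (f t)) * val (f t) n.
    exact: A0_lincombE.
  apply: le_trans (tail_le1 n Nn); apply: (le_trans (ler_norm_sum _ _ _)).
  apply: ler_sum => t _; rewrite normrM -[leRHS]mul1r ler_wpM2r//.
  by rewrite normr_sg; case: (_ != _).
rewrite -phig phi_tail; apply: (le_trans (ler_norm _)).
apply: (le_trans (phi_le _)); apply: (@le_trans _ _ (`|C| * `|tailA0 N g|)).
  by rewrite ler_wpM2r// ler_norm.
by rewrite -[leRHS]mulr1 ler_wpM2l.
Qed.

Lemma countable_functional_neq0 : countable [set t | phi (f t) != 0].
Proof.
(* If S m were infinite, k elements of it with k > |C| * m.+1 would contradict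
   the bound on sums. *)
pose S m := [set t | m.+1%:R^-1 <= `|phi (f t)|].
have -> : [set t | phi (f t) != 0] = \bigcup_m S m.
  apply/seteqP; split => [t /= pt0|t [m _ /= St]]; last first.
    by rewrite -normr_gt0; apply: lt_le_trans St; rewrite invr_gt0.
  have /ltr_add_invr[m] : 0 < `|phi (f t)| by rewrite normr_gt0.
  by rewrite add0r => /ltW; exists m.
apply: bigcup_countable => // m _; apply: finite_set_countable.
apply: contrapT => S_infinite.
pose k := (Num.truncn `|C * m.+1%:R|).+1.
have [B BS kB] := infinite_set_fset k S_infinite.
have: k%:R * m.+1%:R^-1 <= `|C|.
  have := sum_functional_le (finmap.enum_fset B) (finmap.fset_uniq B).
  apply: le_trans.
  apply: (@le_trans _ _ (\sum_(t <- finmap.enum_fset B) m.+1%:R^-1)).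
    rewrite big_const_seq count_predT iter_addr_0 -[leRHS]mulr_natl.
    by rewrite ler_wpM2r ?invr_ge0// ler_nat.
  rewrite !big_seq; apply: ler_sum => t tB.
  exact: BS.
rewrite ler_pdivrMr// -[X in _ * X]ger0_norm// -normrM leNgt.
by rewrite truncnS_gt.
Qed.

End functional_vanishing_on_c0.

(** * Non-complementation of c0 in A0 *)

Theorem theorem4p2 (R : realType) :
  ~ exists P : {linear A0 R -> c0 R},
      (exists M : R, forall x : A0 R, `|P x| <= M * `|x|) /\
      (forall x : A0 R, subspace_val x \in null_seq ->
        subspace_val (P x) = subspace_val x).
Proof.
case=> P [[M P_le] P_id].
pose f s : A0 R := bump (branch s).
pose phi n (x : A0 R) : R := val x n - val (P x) n.
have phi_linear n : scalar (phi n).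
  move=> a x y; rewrite /phi linearP !A0_valD !linf_addE !A0_valZ !linf_scaleE.
  by rewrite mulrBr addrACA opprD.
pose Phi n : {scalar A0 R} :=
  HB.pack (phi n) (GRing.isLinear.Build _ _ _ *%R (phi n) (phi_linear n)).
have phi_le n x : `|Phi n x| <= (1 + M) * `|x|.
  rewrite mulrDl mul1r; apply: (le_trans (ler_normB _ _)); apply: lerD.
    exact: linf_norm_ub.
  by apply: le_trans (P_le x); apply: linf_norm_ub.
have phi_c0 n x : val x \in null_seq -> Phi n x = 0.
  move=> /P_id Px; rewrite -[LHS]/(subspace_val x n - subspace_val (P x) n).
  by rewrite Px subrr.
have f_le1 s n : `|val (f s) n| <= 1 by apply: tent_norm_le1.
have f_disjoint s t : s <> t ->
    \forall n \near \oo, val (f s) n * val (f t) n = 0.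
  by move=> /branch_almost_disjoint/bump_disjoint.
have neq0_countable : countable (\bigcup_n [set s | Phi n (f s) != 0]).
  apply: bigcup_countable => // n _.
  exact: (countable_functional_neq0 f_le1 f_disjoint (phi_le n) (phi_c0 n)).
have [s s0] : exists s, forall n, Phi n (f s) = 0.
  apply: contrapT => h; apply: uncountable_nat_bool.
  rewrite (_ : setT = \bigcup_n [set s | Phi n (f s) != 0])//.
  apply/seteqP; split => // s _; apply: contrapT => sN; apply: h; exists s => n.
  by apply/eqP/negPn/negP => sn; apply: sN; exists n.
have Pfs : val (f s) = val (P (f s)).
  by apply/val_inj/funext => n; apply/eqP; rewrite -subr_eq0; apply/eqP/s0.
have /negP := @bump_notin_c0 R _ (branch_unbounded s); apply.
by rewrite -[bump_linf _]/(val (f s)) Pfs (valP (P (f s))).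
Qed.
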